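(* The space $(\mathrm{RDS}(I),d_m)$ is a Baire space in the topology induced by the metric $d_m$; that is, the intersection of any countable family of open dense subsets of $\mathrm{RDS}(I)$ is dense in $\mathrm{RDS}(I)$.
   Context: Let $I=[0,1]$. Define $h:(0,1)\to\mathbb{R}$ by $h(x)=\log(x)-\log(1/2)$ for $x\in(0,1/2]$ and $h(x)=\log(1/2)-\log(1-x)$ for $x\in[1/2,1)$, and put $d_h(x,y)=|h(x)-h(y)|$. Let $\mathrm{C}(I)$ be the set of continuous functions $f$ from $I$ onto $I$ such that $f(0)=0$, $f(1)=1$, $f((0,1))\subset(0,1)$, and the (one-sided) derivatives $f'(0),f'(1)$ exist and lie in $(0,\infty)$. It carries the metric $d_{\mathrm{C}(I)}(f,g)=\sup_{x\in(0,1)}d_h(f(x),g(x))$ (which is always finite). Let $\mathrm{RDS}(I)$ be the set of triples $f=(f_0,f_1,p_f)\in\mathrm{C}(I)\times\mathrm{C}(I)\times[0,1]$ such that: (i) $f_0,f_1$ are homeomorphisms; (ii) $f_0(x)<x$ for all $x\in(0,1)$; (iii) $f_1(x)>x$ for all $x\in(0,1)$; (iv) $p_f\in(0,1)$; (v) for $j\in\{0,1\}$, $\Lambda_j=p_f\log f_0'(j)+(1-p_f)\log f_1'(j)>0$. It carries the metric $d_m(f,g)=\max\{d_{\mathrm{C}(I)}(f_0,g_0),d_{\mathrm{C}(I)}(f_1,g_1),|p_f-p_g|\}$. *)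

(* Defs.v *)
From HB Require Import structures.
From mathcomp Require Import all_boot all_order all_algebra.
From mathcomp Require Import all_classical all_reals all_analysis.
From mathcomp Require Import ring lra.

Set Implicit Arguments.
Unset Strict Implicit.
Unset Printing Implicit Defensive.

Import Order.TTheory GRing.Theory Num.Theory.
Import numFieldNormedType.Exports.

Local Open Scope classical_set_scope.
Local Open Scope ring_scope.

Definition baire_space (T : topologicalType) : Prop :=
  forall F : set (set T), countable F ->
    (forall U, F U -> open U /\ dense U) -> dense (\bigcap_(U in F) U).

Section definitions.
Context {R : realType}.
Implicit Types (f g : R -> R) (a x y : R).

Definition diff_quot f a : R -> R := fun t => (f (a + t) - f a) / t.
Definition rderivable f a : Prop := cvg (diff_quot f a @ 0^'+).
Definition lderivable f a : Prop := cvg (diff_quot f a @ 0^'-).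
Definition rderive f a : R := lim (diff_quot f a @ 0^'+).
Definition lderive f a : R := lim (diff_quot f a @ 0^'-).

Definition homeomorphism_on (A B : set R) f : Prop :=
  [/\ set_bij A B f, {within A, continuous f} &
      exists2 g, {within B, continuous g} & {in A, cancel f g}].

(* Only meaningful on ]0, 1[. *)
Definition hfun x : R :=
  if x <= 1 / 2 then ln x - ln (1 / 2) else ln (1 / 2) - ln (1 - x).
Definition dist_h x y : R := `|hfun x - hfun y|.

(* A map of [0, 1] to itself is represented by its extension by 0 to R, so that
   Leibniz equality of representatives is equality of maps on [0, 1]. *)
Record isCI f : Prop := {
  ci_out : forall x, x \notin `[0, 1] -> f x = 0 ;
  ci_continuous : {within `[0, 1], continuous f} ;
  ci_onto : f @` `[0, 1] = `[0, 1]%classic ;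
  ci_at0 : f 0 = 0 ;
  ci_at1 : f 1 = 1 ;
  ci_interior : f @` `]0, 1[ `<=` `]0, 1[ ;
  ci_rderivable0 : rderivable f 0 ;
  ci_rderive0_gt0 : 0 < rderive f 0 ;
  ci_lderivable1 : lderivable f 1 ;
  ci_lderive1_gt0 : 0 < lderive f 1
}.

End definitions.

Record CI (R : realType) := MkCI { ci_fun :> R -> R ; ciP : isCI ci_fun }.

(* A supremum of a nonempty bounded set, by dist_h_bounded below. *)
Definition dist_C {R : realType} (f g : CI R) : R :=
  sup [set dist_h (f x) (g x) | x in `]0, 1[].

Record isRDS {R : realType} (f0 f1 : CI R) (p : R) : Prop := {
  rds_homeo0 : homeomorphism_on `[0, 1] `[0, 1] f0 ;
  rds_homeo1 : homeomorphism_on `[0, 1] `[0, 1] f1 ;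
  rds_below : forall x, x \in `]0, 1[ -> f0 x < x ;
  rds_above : forall x, x \in `]0, 1[ -> x < f1 x ;
  rds_p01 : p \in `]0, 1[ ;
  rds_Lambda0 : 0 < p * ln (rderive f0 0) + (1 - p) * ln (rderive f1 0) ;
  rds_Lambda1 : 0 < p * ln (lderive f0 1) + (1 - p) * ln (lderive f1 1)
}.

Record RDS (R : realType) := MkRDS {
  rds_f0 : CI R ;
  rds_f1 : CI R ;
  rds_p : R ;
  rdsP : isRDS rds_f0 rds_f1 rds_p
}.

Definition dist_m {R : realType} (f g : RDS R) : R :=
  Num.max (Num.max (dist_C (rds_f0 f) (rds_f0 g)) (dist_C (rds_f1 f) (rds_f1 g)))
          `|rds_p f - rds_p g|.

Section metric_CI.
Context {R : realType}.
Implicit Types (x y z : R) (f g k : CI R).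

Lemma ln_half_le x : 0 < x -> (ln x <= ln (1 / 2)) = (x <= 1 / 2).
Proof. by move=> x0; rewrite ler_ln// posrE; lra. Qed.

Lemma hfun_lt x y : 0 < x -> x < y -> y < 1 -> hfun x < hfun y.
Proof.
move=> x0 xy y1; rewrite /hfun.
have [x2|x2] := leP x (1 / 2); have [y2|y2] := leP y (1 / 2).
- by rewrite ltrD2r ltr_ln ?posrE//; lra.
- have := ln_half_le x0; rewrite x2 => lx.
  have : ln (1 - y) < ln (1 / 2) by rewrite ltr_ln ?posrE; lra.
  by lra.
- by lra.
- have : ln (1 - y) < ln (1 - x) by rewrite ltr_ln ?posrE; lra.
  by lra.
Qed.

Lemma hfun_le x y : 0 < x -> x <= y -> y < 1 -> hfun x <= hfun y.
Proof.
move=> x0; rewrite le_eqVlt => /predU1P[->//|xy y1].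
exact/ltW/hfun_lt.
Qed.

Lemma hfun_inj x y : x \in `]0, 1[ -> y \in `]0, 1[ -> hfun x = hfun y -> x = y.
Proof.
rewrite !in_itv/= => /andP[x0 x1] /andP[y0 y1] hxy.
have [xy|yx|//] := ltgtP x y.
- by have := hfun_lt x0 xy y1; rewrite hxy ltxx.
- by have := hfun_lt y0 yx x1; rewrite hxy ltxx.
Qed.

Lemma hfunN x : hfun (1 - x) = - hfun x.
Proof.
rewrite /hfun.
have [x2|x2|->] := ltgtP x (1 / 2).
- rewrite ifF; last by apply/negbTE; rewrite -ltNge; lra.
  by rewrite subKr opprB.
- by rewrite ifT; [ring|lra].
- by rewrite (_ : 1 - 1 / 2 = 1 / 2); [rewrite lexx; ring|field].
Qed.

Lemma hfun_near0 (f : R -> R) : f 0 = 0 ->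
  (forall x, x \in `]0, 1[ -> f x \in `]0, 1[) ->
  rderivable f 0 -> 0 < rderive f 0 ->
  exists2 d : R, 0 < d < 1 / 2 &
    exists M : R, forall x, 0 < x < d -> dist_h (f x) x <= M.
Proof.
move=> f0 fI /cvg_ex[a fa]; rewrite /rderive (cvg_lim _ fa)// => a0.
have near_a : \forall t \near 0^'+, `|a - diff_quot f 0 t| < a / 2.
  by move/cvgrPdist_lt : fa; apply; lra.
move: near_a => [e /= e0 near_a].
have a4 : 0 < (4 * a)^-1 by rewrite invr_gt0; lra.
exists (Num.min e (Num.min (1 / 3) (4 * a)^-1)).
  by rewrite !lt_min !gt_min e0 a4; apply/andP; split; [lra|
    apply/orP; right; apply/orP; left; lra].
exists (`|ln (a / 2)| + `|ln (2 * a)|) => x.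
rewrite !lt_min => /andP[x0 /andP[xe /andP[x3 xa]]].
have x01 : x \in `]0, 1[ by rewrite in_itv/=; lra.
have := fI _ x01; rewrite in_itv/= => /andP[fx0 fx1].
have := near_a x; rewrite /ball_/= sub0r normrN gtr0_norm// => /(_ xe x0).
rewrite /diff_quot add0r f0 subr0; set q := f x / x => qa.
have fxq : f x = q * x by rewrite /q divfK// gt_eqF.
have {}qa : a / 2 < q < 2 * a by move: qa; rewrite ltr_norml => /andP[]; lra.
have xa4 : x * a < 1 / 4.
  have : x * (4 * a) < 1 by rewrite -ltr_pdivlMr ?div1r//; lra.
  lra.
have fx2 : f x <= 1 / 2 by rewrite fxq; nra.
rewrite /dist_h /hfun fx2 ifT; last by lra.
have q0 : 0 < q by lra.
rewrite opprB addrA subrK fxq lnM ?posrE// addrK.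
have [qa1 qa2] : ln (a / 2) <= ln q /\ ln q <= ln (2 * a).
  by split; rewrite ler_ln ?posrE; lra.
rewrite ler_norml; apply/andP; split.
- have := ler_norm (- ln (a / 2)); have := normr_ge0 (ln (2 * a)).
  by rewrite normrN; lra.
- have := ler_norm (ln (2 * a)); have := normr_ge0 (ln (a / 2)).
  by lra.
Qed.

Lemma ci_oo f x : x \in `]0, 1[ -> f x \in `]0, 1[.
Proof. by move=> x01; apply: (ci_interior (ciP f)); exists x. Qed.

Lemma dist_h_id_bounded f :
  exists M : R, forall x, x \in `]0, 1[ -> dist_h (f x) x <= M.
Proof.
have fP := ciP f.
have [d d12 [M0 fM0]] :=
  hfun_near0 (ci_at0 fP) (@ci_oo f) (ci_rderivable0 fP) (ci_rderive0_gt0 fP).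
pose g x := 1 - f (1 - x).
have g0 : g 0 = 0 by rewrite /g subr0 (ci_at1 fP) subrr.
have gI x : x \in `]0, 1[ -> g x \in `]0, 1[.
  move=> x01; have : f (1 - x) \in `]0, 1[.
    by apply: ci_oo; move: x01; rewrite !in_itv/=; lra.
  by rewrite /g !in_itv/=; lra.
have /cvg_ex[b fb] := ci_lderivable1 fP.
have gb : diff_quot g 0 @ 0^'+ --> b.
  have -> : diff_quot g 0 = diff_quot f 1 \o -%R.
    apply/funext => t; rewrite /diff_quot/= /g add0r subr0 invrN mulrN -mulNr.
    by congr (_ / _); ring.
  by move/cvg_at_leftNP : fb; rewrite oppr0.
have dg_gt0 : 0 < rderive g 0.
  rewrite /rderive (cvg_lim _ gb)// -(cvg_lim _ fb)//.
  exact: (ci_lderive1_gt0 fP).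
have [c c12 [M1 gM1]] := hfun_near0 g0 gI (cvgP _ gb) dg_gt0.
have cfd : {within `[d, 1 - c], continuous f}.
  apply: continuous_subspaceW (ci_continuous fP) => x /=.
  by rewrite !in_itv/=; lra.
have dc : d <= 1 - c by lra.
have [u ud fu] := EVT_min dc cfd; have [v vd fv] := EVT_max dc cfd.
have fu01 : f u \in `]0, 1[.
  by apply: ci_oo; move: ud; rewrite !in_itv/=; lra.
have fv01 : f v \in `]0, 1[.
  by apply: ci_oo; move: vd; rewrite !in_itv/=; lra.
pose M2 := `|hfun (f u)| + `|hfun (f v)| + (`|hfun d| + `|hfun (1 - c)|).
exists (`|M0| + `|M1| + M2) => x x01.
have M2_ge0 : 0 <= M2 by rewrite !addr_ge0.
have [xd|dx] := ltP x d.
  have := ler_norm M0; have := normr_ge0 M1.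
  by have := fM0 x; move: x01; rewrite in_itv/= => /andP[-> _] /(_ xd); lra.
have [cx|xc] := ltP (1 - c) x.
  have := ler_norm M1; have := normr_ge0 M0.
  have := gM1 (1 - x); rewrite /g subKr /dist_h !hfunN -opprD normrN.
  by move: x01; rewrite in_itv/= => /andP[x0 x1] /(_ ltac:(lra)); lra.
have xdc : x \in `[d, 1 - c] by rewrite in_itv/= dx xc.
have := ci_oo f x01; move: x01 fu01 fv01; rewrite !in_itv/=.
move=> /andP[x0 x1] /andP[fu0 fu1] /andP[fv0 fv1] /andP[fx0 fx1].
have h1 := hfun_le fu0 (fu _ xdc) fx1.
have h2 := hfun_le fx0 (fv _ xdc) fv1.
have h3 : hfun d <= hfun x by apply: hfun_le => //; lra.
have h4 : hfun x <= hfun (1 - c) by apply: hfun_le => //; lra.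
apply: (@le_trans _ _ M2); last first.
  by have := normr_ge0 M0; have := normr_ge0 M1; lra.
rewrite /dist_h /M2 ler_norml.
have n1 := ler_norm (- hfun (f u)); have n2 := ler_norm (hfun (f v)).
have n3 := ler_norm (- hfun d); have n4 := ler_norm (hfun (1 - c)).
have n5 := normr_ge0 (hfun (f u)); have n6 := normr_ge0 (hfun (f v)).
have n7 := normr_ge0 (hfun d); have n8 := normr_ge0 (hfun (1 - c)).
by rewrite normrN in n1; rewrite normrN in n3; lra.
Qed.

Lemma dist_h_triangle y x z : dist_h x z <= dist_h x y + dist_h y z.
Proof. by rewrite /dist_h (le_trans _ (ler_normD _ _))// addrA subrK. Qed.

Lemma dist_hC x y : dist_h x y = dist_h y x.
Proof. exact: distrC. Qed.

Lemma dist_h_bounded f g :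
  has_sup [set dist_h (f x) (g x) | x in `]0, 1[].
Proof.
split; first by exists (dist_h (f 2^-1) (g 2^-1)), 2^-1 => //=;
  rewrite in_itv/=; lra.
have [M fM] := dist_h_id_bounded f; have [N gN] := dist_h_id_bounded g.
exists (M + N) => _ [x x01 <-]; apply: le_trans (dist_h_triangle x _ _) _.
by rewrite lerD ?fM// dist_hC gN.
Qed.

Lemma dist_C_ub f g x : x \in `]0, 1[ -> dist_h (f x) (g x) <= dist_C f g.
Proof.
by move=> x01; apply: sup_upper_bound; [exact: dist_h_bounded|exists x].
Qed.

Lemma dist_C_le f g (M : R) :
  (forall x, x \in `]0, 1[ -> dist_h (f x) (g x) <= M) -> dist_C f g <= M.
Proof.
move=> fgM; apply: ge_sup; first by have [] := dist_h_bounded f g.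
by move=> _ [x x01 <-]; exact: fgM.
Qed.

Lemma dist_C_ge0 f g : 0 <= dist_C f g.
Proof.
have half01 : (2^-1 : R) \in `]0, 1[ by rewrite in_itv/=; lra.
exact: le_trans (normr_ge0 _) (dist_C_ub f g half01).
Qed.

Lemma dist_Cxx f : dist_C f f = 0.
Proof.
apply/eqP; rewrite eq_le dist_C_ge0 andbT.
by apply: dist_C_le => x _; rewrite /dist_h subrr normr0.
Qed.

Lemma dist_C_sym f g : dist_C f g = dist_C g f.
Proof.
by apply/eqP; rewrite eq_le !dist_C_le// => x x01; rewrite dist_hC dist_C_ub.
Qed.

Lemma dist_C_triangle g f k : dist_C f k <= dist_C f g + dist_C g k.
Proof.
apply: dist_C_le => x x01; apply: le_trans (dist_h_triangle (g x) _ _) _.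
by rewrite lerD ?dist_C_ub.
Qed.

Lemma ci_eq f g : (forall x, x \in `]0, 1[ -> f x = g x) -> f = g.
Proof.
move: f g => [f fP] [g gP] /= fg.
suff E : f = g by move: fP gP; rewrite E => fP gP; rewrite (Prop_irrelevance fP gP).
apply/funext => x; have [x01|x01] := boolP (x \in `[0, 1]); last first.
  by rewrite (ci_out fP)// (ci_out gP).
have [->|xn0] := eqVneq x 0; first by rewrite (ci_at0 fP) (ci_at0 gP).
have [->|xn1] := eqVneq x 1; first by rewrite (ci_at1 fP) (ci_at1 gP).
apply: fg; move: x01; rewrite !in_itv/= => /andP[x0 x1].
by rewrite !lt_neqAle x0 x1 xn1 eq_sym xn0.
Qed.

Lemma dist_C_eq0 f g : dist_C f g = 0 -> f = g.
Proof.
move=> fg0; apply: ci_eq => x x01; apply: hfun_inj; [exact: ci_oo..|].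
apply/eqP; rewrite -subr_eq0 -normr_le0 -fg0.
exact: dist_C_ub.
Qed.

End metric_CI.

HB.instance Definition _ (R : realType) := gen_eqMixin (CI R).
HB.instance Definition _ (R : realType) := gen_choiceMixin (CI R).
HB.instance Definition _ (R : realType) := isMetric.Build R (CI R)
  (@dist_Cxx R) (@dist_C_eq0 R) (@dist_C_sym R) (@dist_C_triangle R).

Section metric_RDS.
Context {R : realType}.
Implicit Types f g k : RDS R.

Lemma dist_mxx f : dist_m f f = 0.
Proof. by rewrite /dist_m !dist_Cxx subrr normr0 !maxxx. Qed.

Lemma dist_m_sym f g : dist_m f g = dist_m g f.
Proof.
by rewrite /dist_m distrC; congr (Num.max (Num.max _ _) _); exact: dist_C_sym.
Qed.

Lemma dist_m_triangle g f k : dist_m f k <= dist_m f g + dist_m g k.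
Proof.
rewrite [leLHS]/dist_m !ge_max; apply/andP; split; first (apply/andP; split).
- apply: le_trans (dist_C_triangle (rds_f0 g) _ _) _.
  by rewrite lerD// /dist_m !le_max lexx.
- apply: le_trans (dist_C_triangle (rds_f1 g) _ _) _.
  by rewrite lerD// /dist_m !le_max lexx orbT.
- apply: le_trans (ler_distD (rds_p g) _ _) _.
  by rewrite lerD// /dist_m !le_max lexx orbT.
Qed.

Lemma dist_m_eq0 f g : dist_m f g = 0 -> f = g.
Proof.
move: f g => [f0 f1 p fP] [g0 g1 q gP]; rewrite /dist_m/= => fg0.
have : Num.max (Num.max (dist_C f0 g0) (dist_C f1 g1)) `|p - q| <= 0.
  by rewrite fg0.
rewrite !ge_max => /andP[/andP[E0 E1]]; rewrite normr_le0 subr_eq0 => /eqP Ep.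
have E0' : f0 = g0 by apply/dist_C_eq0/eqP; rewrite eq_le E0 dist_C_ge0.
have E1' : f1 = g1 by apply/dist_C_eq0/eqP; rewrite eq_le E1 dist_C_ge0.
by subst g0 g1 q; rewrite (Prop_irrelevance fP gP).
Qed.

End metric_RDS.

HB.instance Definition _ (R : realType) := gen_eqMixin (RDS R).
HB.instance Definition _ (R : realType) := gen_choiceMixin (RDS R).
HB.instance Definition _ (R : realType) := isMetric.Build R (RDS R)
  (@dist_mxx R) (@dist_m_eq0 R) (@dist_m_sym R) (@dist_m_triangle R).

(* Main.v *)
Require Import Defs.
From mathcomp Require Import all_boot all_order all_algebra.
From mathcomp Require Import all_classical all_reals all_analysis.
From mathcomp Require Import borel_hierarchy ring lra.

(* RDS(I) embeds isometrically in CI * CI * R. The latter is complete: in the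
   coordinate h, distances in CI are uniform distances, and
   h (f t) - h t = ln (f t / t) for small t > 0, so one-sided derivatives at the
   endpoints converge along with uniform limits. The image of RDS(I) is a G_delta:
   a map in CI is a homeomorphism iff f q < f r for all rationals q < r, the
   conditions f_0 < id < f_1 are open on each compact subinterval of ]0, 1[, and
   the conditions on p and on the Lambda_j are open because f |-> ln (f' j) is
   1-Lipschitz. A G_delta in a complete space is Baire. *)

Set Implicit Arguments.
Unset Strict Implicit.
Unset Printing Implicit Defensive.

Import Order.TTheory GRing.Theory Num.Theory.
Import numFieldNormedType.Exports.

Local Open Scope classical_set_scope.
Local Open Scope ring_scope.

(** * Baire property of G_delta subsets of complete spaces *)

Definition complete_space (T : uniformType) : Prop :=
  forall F : set_system T, ProperFilter F -> cauchy F -> exists l : T, F --> l.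

(** An injection [c] of the countable family into nat turns it into a sequence. An index outside the
    image of [c] gets an empty intersection, that is the whole space, which is open and dense; this
    covers finite and empty families as well. *)
Lemma baire_space_seq (T : topologicalType) :
  (forall U : (set T)^nat, (forall n, open (U n) /\ dense (U n)) ->
    dense (\bigcap_n U n)) -> baire_space T.
Proof.
move=> baireT F /countable_injP[c cinj] Fod.
pose U n : set T := \bigcap_(A in [set A | F A /\ c A = n]) A.
have UE A : F A -> U (c A) = A.
  move=> FA; apply/seteqP; split=> [x|x Ax B [FB cB]]; first by apply.
  by have -> : B = A by apply: cinj => //; exact/mem_set.
have Uod n : open (U n) /\ dense (U n).
  have [[A [FA <-]]|nA] := pselect (exists A, F A /\ c A = n).
    by rewrite UE//; exact: Fod.
  have -> : U n = setT.
    by apply/seteqP; split=> // x _ A FcA; case: nA; exists A.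
  by split; [exact: openT|move=> O [x Ox] _; exists x].
have := baireT U Uod; congr dense; apply/seteqP; split=> [x Ux A FA|x Ax n _ A [FA _]].
  by rewrite -(UE A)//; exact: Ux.
exact: Ax.
Qed.

Lemma open_ball_in (R : realType) (X : pseudoMetricType R) (U : set X) (x : X) :
  open U -> U x -> exists2 r : R, 0 < r & ball x r `<=` U.
Proof.
move=> oU Ux; have /nbhs_ballP[r /= r0 xrU] : nbhs x U by exact: open_nbhs_nbhs.
by exists r.
Qed.

(* Nested balls: the n-th ball also lies in the n-th open set defining the range
   of [e], so the limit of the centres taken in [X] comes back to [T]. *)
Lemma Gdelta_baire_space (R : realType) (T X : pseudoMetricType R) (e : T -> X) :
  complete_space X ->
  (forall x y r, ball x r y <-> ball (e x) r (e y)) ->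
  Gdelta (range e) -> baire_space T.
Proof.
move=> cX eball [G oG Ge]; apply: baire_space_seq => U Uod V [x0 Vx0] oV.
have eG t n : G n (e t) by have : range e (e t) by [exists t]; rewrite Ge; apply.
(* A state records the step number, the centre and the radius. The limit of the centres is only
   known to lie in the balls of doubled radius, so [good] asks for its inclusions at twice the new
   radius. *)
pose S : Type := nat * T * {posnum R}.
pose good (s s' : S) := [/\ s'.1.1 = s.1.1.+1, s'.2%:num <= s.2%:num / 2,
  ball (e s'.1.2) (2 * s'.2%:num) `<=` G s.1.1 &
  ball s'.1.2 (2 * s'.2%:num) `<=` U s.1.1 `&` ball s.1.2 s.2%:num].
have step s : exists s', good s s'.
  case: s => [[n x] r].
  have [oU dU] := Uod n.
  have [y [yb Uy]] : (ball x r%:num)° `&` U n !=set0.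
    by apply: dU; [exists x; exact: nbhsx_ballx|exact: open_interior].
  have [r1 r10 yr1] := open_ball_in (openI (@open_interior _ (ball x r%:num)) oU) (conj yb Uy).
  have [r2 r20 yr2] := open_ball_in (oG n) (eG y n).
  (* The first term makes the radii decrease geometrically; the other two make the doubled ball fit
     in the balls of radius [r1] and [r2]. *)
  pose r' := Num.min (r%:num / 2) (Num.min (r1 / 2) (r2 / 2)).
  have r'0 : 0 < r' by rewrite !lt_min !divr_gt0.
  exists (n.+1, y, PosNum r'0); split => //=.
  - by rewrite ge_min lexx.
  - apply: subset_trans yr2; apply: le_ball.
    by rewrite mulrC -ler_pdivlMr// /r' !ge_min lexx !orbT.
  - move=> z yz; suff /yr1[/interior_subset xz Uz] : ball y r1 z by [].
    apply: le_ball yz.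
    by rewrite mulrC -ler_pdivlMr// /r' !ge_min lexx !orbT.
have [r0 r00 x0r0] := open_ball_in oV Vx0.
have [f [f0 fgood]] := dependent_choice (fun s => cid (step s)) (0%N, x0, PosNum r00).
have fn n : (f n).1.1 = n.
  by elim: n => [|n IH]; [rewrite f0|have [-> _ _ _] := fgood n; rewrite IH].
pose x n := (f n).1.2; pose r n := (f n).2%:num.
have rpos n : 0 < r n by rewrite /r gt0.
have nest n k : ball (x (n + k)%N) (r (n + k)%N) `<=` ball (x n) (r n).
  elim: k => [|k IH]; first by rewrite addn0.
  apply: subset_trans IH; rewrite addnS.
  have [_ _ _ sub] := fgood (n + k)%N.
  move=> z xz; have [|//] := sub z _.
  by apply: le_ball xz; rewrite -/(r _) ler_peMl ?ler1n// ltW.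
have xin n k : (n <= k)%N -> ball (x n) (r n) (x k).
  by move=> /subnKC <-; apply: nest; exact: ballxx.
have rle n : r n <= r 0%N * 2^-1 ^+ n.
  elim: n => [|n IH]; first by rewrite expr0 mulr1.
  have [_ le _ _] := fgood n; apply: le_trans le _.
  by rewrite exprSr mulrA ler_pM2r.
have [l xl] : exists l : X, e (x n) @[n --> \oo] --> l.
  apply: (cX (e (x n) @[n --> \oo])); apply: cauchy_exP => eps eps0.
  have /cvgrPdist_lt/(_ _ eps0)[N _ /(_ N (leqnn N))] : r 0%N * 2^-1 ^+ n @[n --> \oo] --> (0 : R).
    by apply: cvg_geometric; rewrite ger0_norm ?invr_ge0// invf_lt1 ?ltr1n.
  rewrite sub0r normrN => rN; exists (e (x N)), N => // k /= Nk.
  apply/eball; apply: le_ball (xin _ _ Nk).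
  by apply: le_trans (rle N) _; apply: le_trans (ler_norm _) (ltW rN).
(* A late centre is within [r n] of both [x n] and the limit. *)
have lin n : ball (e (x n)) (2 * r n) l.
  have /cvg_ballP/(_ _ (rpos n))[N _ lN] := xl.
  have := lN (maxn n N) (leq_maxr _ _); rewrite mulr_natl mulr2n => /ball_sym.
  apply: ball_triangle; apply/eball; apply: xin; exact: leq_maxl.
have [t _ tl] : range e l.
  (* The inclusion in [G n] concerns the ball chosen at step n, which is the one of index n + 1. *)
  rewrite Ge => n _; have [_ _ sub _] := fgood n.
  by rewrite -(fn n); exact: sub (lin n.+1).
have tin n : ball (x n) (2 * r n) t by apply/eball; rewrite tl.
exists t; split => [|n _].
  apply: x0r0; have [_ _ _ sub] := fgood 0%N.
  by have [_] := sub t (tin 1%N); rewrite f0.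
by have [_ _ _ sub] := fgood n; have [] := sub t (tin n.+1); rewrite fn.
Qed.

(** * The coordinate h and one-sided derivatives at the endpoints *)

Section dist_h_theory.
Context {R : realType}.
Implicit Types (f g l : R -> R) (x y : R).

(** From ln (1 + u) <= u with u = x / y - 1, one gets ln y - ln x >= (y - x) / y, and y <= 1. *)
Lemma ler_ln_sub x y : 0 < x -> x <= y -> y <= 1 -> y - x <= ln y - ln x.
Proof.
move=> x0 xy y1; have y0 : 0 < y by exact: lt_le_trans xy.
have q0 : 0 < x / y by rewrite divr_gt0.
have : ln (1 + (x / y - 1)) <= x / y - 1 by apply: le_ln1Dx; lra.
rewrite addrC subrK ln_div ?posrE// => le.
have : x / y * y = x by rewrite divfK// gt_eqF.
by nra.
Qed.

(** Both branches of h inherit slope at least 1 from the logarithm; when 1/2 separates the points,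
    the interval is cut there. *)
Lemma ler_hfun_sub x y : 0 < x -> x <= y -> y < 1 -> y - x <= hfun y - hfun x.
Proof.
move=> x0 xy y1; rewrite /hfun.
have [x2|x2] := leP x (1 / 2); have [y2|y2] := leP y (1 / 2); last 2 first.
- by lra.
- have := @ler_ln_sub (1 - y) (1 - x); lra.
- have := @ler_ln_sub x y; lra.
- have := @ler_ln_sub x (1 / 2); have := @ler_ln_sub (1 - y) (1 / 2); lra.
Qed.

(** Makes evaluations at interior points 1-Lipschitz on CI, and limits for [dist_C] uniform in the
    usual sense. *)
Lemma ler_dist_h x y : x \in `]0, 1[ -> y \in `]0, 1[ -> `|x - y| <= dist_h x y.
Proof.
wlog xy : x y / y <= x => [wl x01 y01|].
  by have [/wl|/ltW/wl] := leP y x; [apply|rewrite distrC dist_hC; apply].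
rewrite !in_itv/= => /andP[x0 x1] /andP[y0 y1].
by rewrite ger0_norm ?subr_ge0//; apply: le_trans (ler_norm _); exact: ler_hfun_sub.
Qed.

(** The inverse of h; the sign test selects the branch because h vanishes at 1/2. *)
Definition hinv x : R := if x <= 0 then expR x / 2 else 1 - expR (- x) / 2.

Lemma hinv_oo x : hinv x \in `]0, 1[.
Proof.
rewrite in_itv/= /hinv; have := expR_gt0 x; have := expR_gt0 (- x).
have [|x0] := leP x 0; first by rewrite -expR_le1; lra.
by have := expR_lt1 (- x); rewrite oppr_lt0 x0; lra.
Qed.

Lemma hinvK x : hfun (hinv x) = x.
Proof.
have := expR_gt0 x; have := expR_gt0 (- x); rewrite /hfun /hinv.
have [|x0] := leP x 0.
  rewrite -expR_le1 => e1 _ e0; rewrite ifT; last by lra.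
  by rewrite !ln_div ?posrE// expRK ln1; ring.
move=> e0 _; rewrite ifF; first by rewrite subKr !ln_div ?posrE// expRK ln1; ring.
by apply/negbTE; rewrite -ltNge; have := expR_lt1 (- x); rewrite oppr_lt0 x0; lra.
Qed.

Definition maps01 f := forall x, x \in `]0, 1[ -> f x \in `]0, 1[.

(** Displacement under f in the coordinate h. Its limit at 0 is the logarithm of the right
    derivative, which turns statements on derivatives into statements on uniformly close
    functions. *)
Definition hdrift f : R -> R := fun t => hfun (f t) - hfun t.

Lemma near0_oo : \forall t \near (0 : R)^'+, t \in `]0, 1 / 2[.
Proof. by near=> t; rewrite in_itv/=; apply/andP; split=> //. Unshelve. all: by end_near. Qed.

(** Once t and f t are below 1/2, both lie in the first branch of h and the constants ln (1/2)
    cancel. *)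
Lemma hdriftE f : f 0 = 0 -> maps01 f -> f t @[t --> 0^'+] --> 0 ->
  \forall t \near 0^'+, 0 < diff_quot f 0 t /\ hdrift f t = ln (diff_quot f 0 t).
Proof.
move=> f0 fI ft; have := cvgr_lt 0 ft; move=> /(_ _ (1 / 2)) f2.
near=> t.
have /andP[t0 t2] : 0 < t < 1 / 2.
  by have : t \in `]0, 1 / 2[; [near: t; exact: near0_oo|rewrite in_itv].
have ft2 : f t < 1 / 2 by near: t; apply: f2; lra.
have : f t \in `]0, 1[ by apply: fI; rewrite in_itv/=; lra.
rewrite in_itv/= => /andP[ft0 _].
rewrite /diff_quot add0r f0 subr0; split; first by rewrite divr_gt0.
by rewrite /hdrift /hfun !ifT ?ltW// ln_div ?posrE//; ring.
Unshelve. all: by end_near. Qed.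

Lemma rderivable_cvg f : f 0 = 0 -> rderivable f 0 -> f t @[t --> 0^'+] --> 0.
Proof.
move=> f0 /cvg_ex[a fa].
have : diff_quot f 0 t * t @[t --> 0^'+] --> a * 0.
  by apply: cvgM fa _; apply: cvg_at_right_filter; exact: cvg_id.
rewrite mulr0; apply: cvg_trans; apply: near_eq_cvg; near=> t.
by rewrite /diff_quot add0r f0 subr0 divfK// gt_eqF.
Unshelve. all: by end_near. Qed.

Lemma cvg_hdrift f : f 0 = 0 -> maps01 f -> rderivable f 0 -> 0 < rderive f 0 ->
  hdrift f t @[t --> 0^'+] --> ln (rderive f 0).
Proof.
move=> f0 fI fd a0; have fE := hdriftE f0 fI (rderivable_cvg f0 fd).
have : ln (diff_quot f 0 t) @[t --> 0^'+] --> ln (rderive f 0).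
  by apply: continuous_cvg fd; exact: continuous_ln.
by apply: cvg_trans; apply: near_eq_cvg; apply: filterS fE => t [].
Qed.

(** Exponentiating, f t / t tends to exp b, which is automatically positive. *)
Lemma hdrift_cvg_rderive f (b : R) : f 0 = 0 -> maps01 f -> f t @[t --> 0^'+] --> 0 ->
  hdrift f t @[t --> 0^'+] --> b -> rderivable f 0 /\ 0 < rderive f 0.
Proof.
move=> f0 fI ft fb; have fE := hdriftE f0 fI ft.
have q : diff_quot f 0 t @[t --> 0^'+] --> expR b.
  have : expR (hdrift f t) @[t --> 0^'+] --> expR b.
    by apply: continuous_cvg fb; exact: continuous_expR.
  apply: cvg_trans; apply: near_eq_cvg; apply: filterS fE => t [q0 ->].
  by rewrite lnK.
by split; [exact: cvgP q|rewrite /rderive (cvg_lim _ q)// expR_gt0].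
Qed.

(** The drifts of f and l differ by h (f t) - h (l t), so near 0 the drift of l stays within e of
    the limit of the drift of f. It is therefore Cauchy at 0, and R is complete. *)
Lemma rderivable_uniform_limit l : l 0 = 0 -> maps01 l -> l t @[t --> 0^'+] --> 0 ->
  (forall e, 0 < e -> exists f, [/\ f 0 = 0, maps01 f, rderivable f 0,
    0 < rderive f 0 & forall x, x \in `]0, 1[ -> dist_h (f x) (l x) <= e]) ->
  rderivable l 0 /\ 0 < rderive l 0.
Proof.
move=> l0 lI lt lf.
suff /cvg_ex[b lb] : cvg (hdrift l t @[t --> 0^'+]) by exact: hdrift_cvg_rderive lb.
apply/cauchy_cvgP/cauchy_exP => e e0.
have [f [f0 fI fd fd0 fl]] := lf (e / 2) (divr_gt0 e0 (ltr0Sn _ _)).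
exists (ln (rderive f 0)); rewrite /fmap/=; near=> t.
have t01 : t \in `]0, 1[.
  have : t \in `]0, 1 / 2[ by near: t; exact: near0_oo.
  by rewrite !in_itv/=; lra.
rewrite /ball/=.
have lt_ft : `|ln (rderive f 0) - hdrift f t| < e / 2.
  near: t; move/cvgrPdist_lt : (cvg_hdrift f0 fI fd fd0); apply.
  by rewrite divr_gt0.
have le_l : `|hdrift f t - hdrift l t| <= e / 2.
  by rewrite /hdrift opprB addrA subrK; exact: fl.
apply: le_lt_trans (ler_distD (hdrift f t) _ _) _.
by rewrite [ltRHS](splitr e) ltr_leD.
Unshelve. all: by end_near. Qed.

(** The terms h t cancel in the difference of the drifts; let t tend to 0. *)
Lemma ln_rderive_le f g (M : R) :
  f 0 = 0 -> maps01 f -> rderivable f 0 -> 0 < rderive f 0 ->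
  g 0 = 0 -> maps01 g -> rderivable g 0 -> 0 < rderive g 0 ->
  (forall x, x \in `]0, 1[ -> dist_h (f x) (g x) <= M) ->
  `|ln (rderive f 0) - ln (rderive g 0)| <= M.
Proof.
move=> f0 fI fd fd0 g0 gI gd gd0 fgM.
have fg : `|hdrift f t - hdrift g t| @[t --> 0^'+] -->
    `|ln (rderive f 0) - ln (rderive g 0)|.
  by apply: cvg_norm; apply: cvgB; exact: cvg_hdrift.
apply: cvgr_to_le fg _; near=> t; rewrite /hdrift opprB addrA subrK.
apply: fgM; have : t \in `]0, 1 / 2[ by near: t; exact: near0_oo.
by rewrite !in_itv/=; lra.
Unshelve. all: by end_near. Qed.

(** Conjugation by x |-> 1 - x exchanges the endpoints and, since h (1 - x) = - h x, preserves
    [dist_h]. It reduces derivatives at 1 to derivatives at 0. *)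
Definition rev01 f : R -> R := fun x => 1 - f (1 - x).

Lemma rev01_maps01 f : maps01 f -> maps01 (rev01 f).
Proof.
move=> fI x x01; have : f (1 - x) \in `]0, 1[.
  by apply: fI; move: x01; rewrite !in_itv/=; lra.
by rewrite /rev01 !in_itv/=; lra.
Qed.

Lemma rev01_at0 f : f 1 = 1 -> rev01 f 0 = 0.
Proof. by move=> f1; rewrite /rev01 subr0 f1 subrr. Qed.

Lemma diff_quot_rev01 f : f 1 = 1 ->
  diff_quot (rev01 f) 0 @ 0^'+ = diff_quot f 1 @ 0^'-.
Proof.
move=> f1; have -> : (0 : R)^'- = -%R @ 0^'+ by rewrite -at_leftN oppr0.
suff -> : diff_quot (rev01 f) 0 = diff_quot f 1 \o -%R by [].
apply/funext => t; rewrite /diff_quot/= /rev01 add0r subr0 f1 invrN mulrN -mulNr.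
by congr (_ / _); ring.
Qed.

Lemma dist_h_rev01 f g x : dist_h (rev01 f x) (rev01 g x) = dist_h (f (1 - x)) (g (1 - x)).
Proof. by rewrite /dist_h /rev01 !hfunN -opprD normrN. Qed.

End dist_h_theory.

Section CI_theory.
Context {R : realType}.
Implicit Types (f g : CI R) (x y : R).

Lemma ball_dist_h f g (e : R) x : ball f e g -> x \in `]0, 1[ ->
  dist_h (f x) (g x) < e.
Proof. by move=> fg x01; exact: le_lt_trans (dist_C_ub f g x01) fg. Qed.

Lemma ci_maps01 f : maps01 f.
Proof. by move=> x; exact: ci_oo. Qed.

Lemma rderive_rev01 (f : R -> R) : f 1 = 1 -> rderive (rev01 f) 0 = lderive f 1.
Proof. by move=> f1; rewrite /rderive diff_quot_rev01. Qed.

Lemma ci_rev01 f : [/\ rev01 f 0 = 0, maps01 (rev01 f), rderivable (rev01 f) 0 &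
  0 < rderive (rev01 f) 0].
Proof.
have fP := ciP f; split.
- exact/rev01_at0/ci_at1.
- exact/rev01_maps01/ci_maps01.
- by rewrite /rderivable diff_quot_rev01 ?(ci_at1 fP)//; exact: ci_lderivable1.
- by rewrite rderive_rev01 ?(ci_at1 fP)//; exact: ci_lderive1_gt0.
Qed.

Lemma itvcc01P x : x \in `[0, 1] -> [\/ x = 0, x = 1 | x \in `]0, 1[].
Proof.
rewrite !in_itv/= !le_eqVlt => /andP[/predU1P[<-|x0] /predU1P[->|x1]];
  by [constructor 1|constructor 2|constructor 3; rewrite x0 x1].
Qed.

(** Limits are taken pointwise in the coordinate h, where R is complete, and brought back by [hinv],
    so interior points stay interior. The convergence is uniform, hence the limit is continuous,
    onto by the intermediate value theorem, and differentiable at 0 and, after [rev01], at 1. *)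
Lemma CI_complete : complete_space (CI R).
Proof.
move=> F FF Fc.
have {}Fc : forall e : R, 0 < e -> exists f : CI R, F (ball f e).
  exact: (cauchyP (R := R) F).1.
have Fcvg x : x \in `]0, 1[ -> cvg (hfun (ci_fun f x) @[f --> F]).
  move=> x01; apply/cauchy_cvgP/cauchy_exP => e /Fc[f Ff].
  exists (hfun (f x)); rewrite /fmap/=; apply: filterS Ff => g fg.
  exact: ball_dist_h fg x01.
pose L x : R := lim (hfun (ci_fun f x) @[f --> F]).
(* The default is 1 at 1, and 0 both at 0 and off [0, 1], as [isCI] demands. *)
pose l x : R := if x \in `]0, 1[ then hinv (L x) else (x == 1)%:R.
have lI : maps01 l by move=> x x01; rewrite /l x01 hinv_oo.
have l0 : l 0 = 0 by rewrite /l in_itv/= ltxx/= eq_sym oner_eq0.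
have l1 : l 1 = 1 by rewrite /l in_itv/= ltxx andbF eqxx.
have near_l e : 0 < e ->
    \forall f \near F, forall x, x \in `]0, 1[ -> dist_h (ci_fun f x) (l x) <= e.
  move=> e0; have [f Ff] := Fc _ (divr_gt0 e0 (ltr0Sn _ 1)).
  apply: filterS (Ff) => g /= fg x x01; apply: le_trans (dist_h_triangle (f x) _ _) _.
  rewrite (splitr e) lerD//.
    by rewrite dist_hC; apply: ltW; exact: ball_dist_h fg x01.
  rewrite /dist_h /l x01 hinvK.
  (* The bound on [dist_h (f x) (k x)] holds for F-most k, with the same bound for every x, and
     passes to the limit in k. *)
  have : `|hfun (f x) - hfun (ci_fun k x)| @[k --> F] --> `|hfun (f x) - L x|.
    by apply: cvg_norm; apply: cvgB; [exact: cvg_cst|exact: Fcvg].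
  move=> /cvgr_to_le; apply; apply: filterS Ff => k /= fk.
  by apply: ltW; exact: ball_dist_h fk x01.
have ex_l e : 0 < e -> exists f : CI R,
    forall x, x \in `]0, 1[ -> dist_h (f x) (l x) <= e.
  by move=> e0; exact: filter_ex (near_l e e0).
have lcont : {within `[0, 1], continuous l}.
  apply/subspace_continuousP => x x01; apply/cvgrPdist_lt => e e0.
  have [f fl] := ex_l (e / 3) (divr_gt0 e0 (ltr0Sn _ 2)).
  have {}fl y : y \in `[0, 1] -> `|f y - l y| <= e / 3.
    move=> /itvcc01P[->|->|y01].
    - by rewrite l0 (ci_at0 (ciP f)) subrr normr0 ltW// divr_gt0.
    - by rewrite l1 (ci_at1 (ciP f)) subrr normr0 ltW// divr_gt0.
    - apply: le_trans (fl _ y01).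
      by apply: ler_dist_h; [exact: ci_oo|exact: lI].
  have /subspace_continuousP/(_ x x01)/cvgrPdist_lt := ci_continuous (ciP f).
  move=> /(_ (e / 3) (divr_gt0 e0 (ltr0Sn _ 2))); rewrite !near_withinE.
  apply: filterS => y /[swap] y01 /(_ y01) fxy.
  have := fl y y01; have := fl x x01; move: fxy.
  by rewrite /from_subspace !ltr_norml !ler_norml; lra.
have l_at0 : l t @[t --> 0^'+] --> 0.
  by have /(continuous_within_itvP _ ltr01)[_ + _] := lcont; rewrite l0.
have l_at1 : rev01 l t @[t --> 0^'+] --> 0.
  apply/cvgrPdist_lt => e e0.
  have /subspace_continuousP/(_ 1) := lcont; rewrite /= in_itv/= ler01 lexx.
  move=> /(_ isT)/cvgrPdist_lt/(_ _ e0); rewrite near_withinE => -[d /= d0 dl].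
  near=> t.
  have : t \in `]0, 1 / 2[ by near: t; exact: near0_oo.
  rewrite in_itv/= => /andP[t0 t2].
  have td : t < d by near: t; exact: nbhs_right_lt.
  rewrite /rev01 sub0r normrN -{1}l1; apply: dl => /=; last by rewrite in_itv/=; lra.
  by rewrite subKr gtr0_norm.
have [ld0 ld0_gt0] : rderivable l 0 /\ 0 < rderive l 0.
  apply: rderivable_uniform_limit => // e /ex_l[f fl]; exists f.
  have fP := ciP f; split => //; [exact: ci_at0|exact: ci_maps01|
    exact: ci_rderivable0|exact: ci_rderive0_gt0].
have [ld1 ld1_gt0] : rderivable (rev01 l) 0 /\ 0 < rderive (rev01 l) 0.
  apply: rderivable_uniform_limit => //; [exact: rev01_at0|exact: rev01_maps01|].
  move=> e /ex_l[f fl]; exists (rev01 f); have [? ? ? ?] := ci_rev01 f; split => // x x01.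
  by rewrite dist_h_rev01; apply: fl; move: x01; rewrite !in_itv/=; lra.
have lP : isCI l.
  split => //.
  - by move=> x; rewrite /l; case: ifPn => [/subset_itv_oo_cc->//|_];
      case: eqVneq => [->|//]; rewrite in_itv/= ler01 lexx.
  - apply/seteqP; split=> [_ [x x01 <-]|y y01] /=.
      have [->|->|/lI/subset_itv_oo_cc//] := itvcc01P x01.
        by rewrite l0 in_itv/= lexx ler01.
      by rewrite l1 in_itv/= lexx ler01.
    have [|x x01 <-] := @IVT R l 0 1 y ler01 lcont; last by exists x.
    by rewrite l0 l1 (min_idPl _) ?(max_idPr _) ?ler01//; move: y01; rewrite /= in_itv.
  - by move=> _ [x x01 <-]; exact: lI.
  - by move: ld1; rewrite /rderivable diff_quot_rev01.
  - by rewrite -rderive_rev01.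
exists (MkCI lP); apply/(@fcvg_ballP R) => e e0.
(* A supremum only inherits a weak bound; halving e restores strictness. *)
have e2 : 0 < e / 2 by rewrite divr_gt0.
apply: filterS (near_l _ e2) => f fl.
rewrite /ball/=; apply: (@le_lt_trans _ _ (e / 2)); last by lra.
by apply: dist_C_le => x x01; rewrite dist_hC; exact: fl.
Unshelve. all: by end_near. Qed.

End CI_theory.

(** * Stability of G_delta sets; products of complete spaces *)

Lemma Gdelta_bigcap (T : topologicalType) (J : countType) (G : J -> set T) :
  (forall i, open (G i)) -> Gdelta (\bigcap_i G i).
Proof.
move=> oG; exists (fun n => if unpickle n is Some i then G i else setT).
  by move=> n; case: unpickle => // ; exact: openT.
apply/seteqP; split=> x Gx n _; first by case: unpickle => // i; exact: Gx.
by have := Gx (pickle n) I; rewrite pickleK.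
Qed.

Lemma GdeltaI (T : topologicalType) (A B : set T) :
  Gdelta A -> Gdelta B -> Gdelta (A `&` B).
Proof.
move=> [F oF ->] [G oG ->]; exists (fun n => F n `&` G n).
  by move=> n; exact: openI.
by rewrite -bigcapI.
Qed.

Lemma Gdelta_preimage (T U : topologicalType) (f : T -> U) (A : set U) :
  continuous f -> Gdelta A -> Gdelta (f @^-1` A).
Proof.
move=> fc [G oG ->]; exists (fun n => f @^-1` G n); last by rewrite preimage_bigcap.
by move=> n; apply: open_comp => // x _; exact: fc.
Qed.

Lemma open_lt_continuous (R : realType) (T : topologicalType) (f g : T -> R) :
  continuous f -> continuous g -> open [set x | f x < g x].
Proof.
move=> fc gc; rewrite (_ : [set x | _] = [set x | 0 < g x - f x]).
  apply: (open_comp _ (@open_gt R 0)) => x _; apply: cvgB; [exact: gc|exact: fc].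
by apply/seteqP; split=> x /=; rewrite subr_gt0.
Qed.

Lemma complete_space_prod (R : realType) (T U : pseudoMetricType R) :
  complete_space T -> complete_space U -> complete_space (T * U)%type.
Proof.
move=> cT cU F FF Fc.
have {}Fc : forall e : R, 0 < e -> exists z : T * U, F (ball z e).
  exact: (cauchyP (R := R) F).1.
have [a aF] : exists a : T, fst z @[z --> F] --> a.
  apply: (cT (fst @ F)); apply: cauchy_exP => e /Fc[z Fz].
  by exists z.1; rewrite /fmap/=; apply: filterS Fz => y [].
have [b bF] : exists b : U, snd z @[z --> F] --> b.
  apply: (cU (snd @ F)); apply: cauchy_exP => e /Fc[z Fz].
  by exists z.2; rewrite /fmap/=; apply: filterS Fz => y [].
exists (a, b); apply/(@fcvg_ballP R) => e e0.
have aFe : \forall z \near F, ball a e z.1 by move/cvg_ballP : aF; exact.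
have bFe : \forall z \near F, ball b e z.2 by move/cvg_ballP : bF; exact.
by near=> z; split; near: z.
Unshelve. all: by end_near. Qed.

(** * G_delta conditions on a single map of CI *)

Section Gdelta_CI.
Context {R : realType}.
Implicit Types (f g : CI R) (x y : R).

Lemma continuous_dist_C (phi : CI R -> R) :
  (forall f g, `|phi f - phi g| <= dist_C f g) -> continuous phi.
Proof.
move=> lip f A /nbhs_ballP[e /= e0 eA]; apply/(@nbhs_ballP R).
by exists e => // g fg; apply: eA; exact: le_lt_trans (lip f g) fg.
Qed.

Lemma continuous_ci_eval x : x \in `]0, 1[ -> continuous (fun f : CI R => f x).
Proof.
move=> x01; apply: continuous_dist_C => f g; apply: le_trans (dist_C_ub _ _ x01).
by apply: ler_dist_h; exact: ci_oo.
Qed.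

Lemma continuous_ln_rderive0 : continuous (fun f : CI R => ln (rderive f 0)).
Proof.
apply: continuous_dist_C => f g; have fP := ciP f; have gP := ciP g.
apply: ln_rderive_le; [exact: ci_at0|exact: ci_maps01|exact: ci_rderivable0|
  exact: ci_rderive0_gt0|exact: ci_at0|exact: ci_maps01|exact: ci_rderivable0|
  exact: ci_rderive0_gt0|exact: dist_C_ub].
Qed.

Lemma continuous_ln_lderive1 : continuous (fun f : CI R => ln (lderive f 1)).
Proof.
apply: continuous_dist_C => f g; rewrite -!rderive_rev01 ?(ci_at1 (ciP _))//.
have [? ? ? ?] := ci_rev01 f; have [? ? ? ?] := ci_rev01 g.
apply: ln_rderive_le => // x x01; rewrite dist_h_rev01; apply: dist_C_ub.
by move: x01; rewrite !in_itv/=; lra.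
Qed.

(* For c = 1 this is [f x < x], for c = -1 it is [x < f x]. *)
Lemma Gdelta_shift (c : R) : `|c| <= 1 ->
  Gdelta [set f : CI R | forall x, x \in `]0, 1[ -> 0 < c * (x - f x)].
Proof.
(* The compact intervals [K n] exhaust ]0, 1[; the offset 2 keeps [e n] at most 1/2, so that none is
   empty. *)
move=> c1; pose e n : R := n.+2%:R^-1; pose K n : set R := `[e n, 1 - e n]%classic.
have a01 n : 0 < e n <= 1 / 2.
  by rewrite /e invr_gt0 ltr0n div1r lef_pV2 ?posrE ?ltr0n// ler_nat.
pose G n : set (CI R) := [set f | forall x, K n x -> 0 < c * (x - f x)].
rewrite (_ : [set f | _] = \bigcap_n G n).
  apply: Gdelta_bigcap => n.
  rewrite openE => f /= Gf.
  have /andP[a0 a2] := a01 n.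
  have cf : {within `[e n, 1 - e n], continuous (fun x => c * (x - f x))}.
    have fK : {within `[e n, 1 - e n], continuous f}.
      apply: continuous_subspaceW (ci_continuous (ciP f)) => x /=.
      by rewrite !in_itv/=; lra.
    have idK : {within `[e n, 1 - e n], continuous (@id R)}.
      by apply: continuous_subspaceT => x; exact: cvg_id.
    by move=> x; exact: (cvgM (cvg_cst c) (cvgB (idK x) (fK x))).
  have le_ab : e n <= 1 - e n by lra.
  have [u uK umin] := EVT_min le_ab cf.
  (* The positive minimum over [K n] serves as radius: since |c| <= 1, moving f by less than it
     cannot make c (x - f x) reach 0. *)
  rewrite /interior; apply/nbhs_ballP; exists (c * (u - f u)); first exact: Gf.
  move=> g fg x Kx; have x01 : x \in `]0, 1[ by move: Kx; rewrite /K/= !in_itv/=; lra.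
  have := le_lt_trans (ler_dist_h (ci_oo f x01) (ci_oo g x01)) (ball_dist_h fg x01).
  have := umin x Kx.
  have : `|c * (f x - g x)| <= `|f x - g x| by rewrite normrM ler_piMl.
  have := ler_norm (- (c * (f x - g x))); rewrite normrN.
  rewrite !mulrBr; lra.
apply/seteqP; split=> [f fx n _ x Kx|f Gf x x01].
  by apply: fx; have := a01 n; move: Kx; rewrite /K/= !in_itv/=; lra.
have : 0 < Num.min x (1 - x) by move: x01; rewrite in_itv/= lt_min; lra.
move=> m0; pose n := Num.truncn (Num.min x (1 - x))^-1.
apply: (Gf n I); have : e n <= Num.min x (1 - x).
  rewrite /e -[leRHS]invrK lef_pV2 ?posrE ?invr_gt0 ?ltr0n//.
  apply: le_trans (ltW (truncnS_gt _)) _; by rewrite ler_nat.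
by rewrite le_min /K/= in_itv/= => /andP[-> ?]; lra.
Qed.

Lemma near_right_rat x (P : set R) : (\forall t \near x^'+, P t) ->
  exists2 q : rat, x < ratr q & P (ratr q).
Proof.
move=> [d /= d0 dP]; have [|q] := @rat_in_itvoo R x (x + d); first by rewrite ltrDl.
rewrite in_itv/= => /andP[xq qd]; exists q => //; apply: dP => //=.
by rewrite distrC gtr0_norm; lra.
Qed.

Lemma near_left_rat x (P : set R) : (\forall t \near x^'-, P t) ->
  exists2 q : rat, ratr q < x & P (ratr q).
Proof.
move=> [d /= d0 dP]; have [|q] := @rat_in_itvoo R (x - d) x; first by rewrite ltrBlDr ltrDl.
rewrite in_itv/= => /andP[qd xq]; exists q => //; apply: dP => //=.
by rewrite gtr0_norm; lra.
Qed.

(** A continuous injection of a segment with f 0 <= f 1 is increasing. Conversely, a strictly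
    increasing map has a left inverse, which is continuous on the segment; surjectivity is part of
    [isCI]. *)
Lemma ci_homeoP f : homeomorphism_on `[0, 1] `[0, 1] f <->
  {in `[0, 1] &, {homo ci_fun f : x y / x < y}}.
Proof.
have fP := ciP f; split=> [[[_ fi _] fc _]|finc].
  apply/monoW_in/leW_mono_in/segment_continuous_inj_le => //.
    by rewrite (ci_at0 fP) (ci_at1 fP).
  by move=> x y x01 y01; apply: fi; rewrite inE.
have fmono : {in `[0, 1] &, {mono ci_fun f : x y / x <= y}} by exact: le_mono_in.
have finj : {in `[0, 1] &, injective (ci_fun f)} by exact: inc_inj_in.
split; [split| exact: ci_continuous|].
- by move=> x x01; rewrite -(ci_onto fP); exists x.
- by move=> x y; rewrite !inE; exact: finj.
- by move=> y; rewrite -[X in X y](ci_onto fP).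
(* A chosen preimage, with default 0 where there is none. *)
pose g y := xget 0 [set x | x \in `[0, 1] /\ f x = y].
have gK : {in `[0, 1], cancel f g}.
  move=> x x01; rewrite /g; case: xgetP => [z _ [z01 /finj]|/(_ x)[]//]; exact.
exists g; last by move=> x; rewrite inE => x01; exact: gK.
have := segment_can_le_continuous ler01 (ci_continuous fP) gK.
by rewrite (ci_at0 fP) (ci_at1 fP).
Qed.

(** Rephrases the condition as countably many strict inequalities between values at interior points,
    each of them open in f. *)
Lemma ci_homeo_ratP f : homeomorphism_on `[0, 1] `[0, 1] f <->
  forall q r : rat, 0 < ratr q :> R -> q < r -> ratr r < 1 :> R ->
    f (ratr q) < f (ratr r).
Proof.
rewrite ci_homeoP; split=> [finc q r q0 qr r1|frat x y].
  have : ratr q < ratr r :> R by rewrite ltr_rat.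
  by move=> qr'; apply: finc => //; rewrite in_itv/=; lra.
have /(continuous_within_itvP _ ltr01)[foo f0 f1] := ci_continuous (ciP f).
rewrite !in_itv/= => /andP[x0 x1] /andP[y0 y1] xy.
have fx : f t @[t --> x^'+] --> f x.
  move: x0; rewrite le_eqVlt => /predU1P[<-//|x0].
  by apply/cvg_at_right_filter/foo; rewrite in_itv/=; lra.
have fy : f t @[t --> y^'-] --> f y.
  move: y1; rewrite le_eqVlt => /predU1P[->//|y1].
  by apply/cvg_at_left_filter/foo; rewrite in_itv/=; lra.
(* Approximating x from the right and y from the left by rationals gives only weak inequalities;
   strictness comes from two rationals q < r in between. *)
have [q] := rat_in_itvoo xy; rewrite in_itv/= => /andP[xq qy].
have [r] := rat_in_itvoo qy; rewrite in_itv/= => /andP[qr ry].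
have fq_fr : f (ratr q) < f (ratr r).
  by apply: frat; [|rewrite -(ltr_rat R)|]; lra.
have fx_fq : f x <= f (ratr q).
  rewrite leNgt; apply/negP => fqx.
  have [s xs [fs sq]] := near_right_rat (filterI (cvgr_gt _ fx _ fqx) (nbhs_right_lt xq)).
  have : f (ratr s) < f (ratr q) by apply: frat; [|rewrite -(ltr_rat R)|]; lra.
  by rewrite ltNge ltW.
have fr_fy : f (ratr r) <= f y.
  rewrite leNgt; apply/negP => fyr.
  have [s sy [fs rs]] := near_left_rat (filterI (cvgr_lt _ fy _ fyr) (nbhs_left_gt ry)).
  have : f (ratr r) < f (ratr s) by apply: frat; [|rewrite -(ltr_rat R)|]; lra.
  by rewrite ltNge ltW.
exact: le_lt_trans fx_fq (lt_le_trans fq_fr fr_fy).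
Qed.

Lemma Gdelta_homeomorphism :
  Gdelta [set f : CI R | homeomorphism_on `[0, 1] `[0, 1] f].
Proof.
pose G (z : rat * rat) : set (CI R) := [set f | 0 < ratr z.1 :> R -> z.1 < z.2 ->
  ratr z.2 < 1 :> R -> f (ratr z.1) < f (ratr z.2)].
rewrite (_ : [set f | _] = \bigcap_z G z); last first.
  apply/seteqP; split=> [f /ci_homeo_ratP fh [q r] _|f fG]; first exact: fh.
  by apply/ci_homeo_ratP => q r; exact: (fG (q, r) I).
apply: Gdelta_bigcap => -[q r].
have [/and3P[q0 qr r1]|nqr] := boolP [&& 0 < ratr q :> R, q < r & ratr r < 1 :> R].
  have qr' : ratr q < ratr r :> R by rewrite ltr_rat.
  have -> : G (q, r) = [set f | ci_fun f (ratr q) < f (ratr r)].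
    by apply/seteqP; split=> f /= fqr; [exact: fqr|move=> *].
  by apply: open_lt_continuous; apply: continuous_ci_eval; rewrite in_itv/=; lra.
have -> : G (q, r) = setT; last exact: openT.
by apply/seteqP; split=> // f _ /= q0 qr r1; rewrite q0 qr r1 in nqr.
Qed.

End Gdelta_CI.

(** * RDS(I) as a G_delta in the product, and the conclusion *)

Section RDS_Gdelta.
Context {R : realType}.

Definition RDS_triple (f : RDS R) : CI R * CI R * R := (rds_f0 f, rds_f1 f, rds_p f).

(** Balls of the product are products of balls, which matches the maximum in [dist_m]. *)
Lemma ball_RDS_triple (f g : RDS R) (r : R) :
  ball f r g <-> ball (RDS_triple f) r (RDS_triple g).
Proof.
rewrite {1}/ball/= /dist_m !gt_max; split=> [/andP[/andP[]]|[[]]].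
  by split=> //; split.
by move=> h0 h1 hp; apply/andP; split; [apply/andP|].
Qed.

Lemma Gdelta_range_RDS_triple : Gdelta (range RDS_triple).
Proof.
pose X : Type := (CI R * CI R * R)%type.
pose Lambda0 (z : X) := z.2 * ln (rderive z.1.1 0) + (1 - z.2) * ln (rderive z.1.2 0).
pose Lambda1 (z : X) := z.2 * ln (lderive z.1.1 1) + (1 - z.2) * ln (lderive z.1.2 1).
have c0 : continuous (fun z : X => z.1.1).
  by move=> z; apply: (@cvg_comp _ _ _ fst fst _ _ _ cvg_fst cvg_fst).
have c1 : continuous (fun z : X => z.1.2).
  by move=> z; apply: (@cvg_comp _ _ _ fst snd _ _ _ cvg_fst cvg_snd).
have c2 : continuous (fun z : X => z.2) by move=> z; exact: cvg_snd.
(* Here [phi] stands for the logarithm of the derivative at 0 or at 1, so that one argument serves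
   both [Lambda0] and [Lambda1]. *)
have cL (phi : CI R -> R) : continuous phi ->
    continuous (fun z : X => z.2 * phi z.1.1 + (1 - z.2) * phi z.1.2).
  move=> cphi z; apply: cvgD; apply: cvgM; [exact: c2| | |].
    by apply: continuous_comp; [exact: c0|exact: cphi].
    by apply: cvgB; [exact: cvg_cst|exact: c2].
  by apply: continuous_comp; [exact: c1|exact: cphi].
have cc (r : R) : continuous (fun _ : X => r) by move=> z; exact: cvg_cst.
(* The conditions of [isRDS], with f_0 < id and f_1 > id put in the form of [Gdelta_shift] and the
   membership of p split in two. *)
have -> : range RDS_triple =
    (fun z : X => z.1.1) @^-1` [set f | homeomorphism_on `[0, 1] `[0, 1] f] `&`
    (fun z : X => z.1.2) @^-1` [set f | homeomorphism_on `[0, 1] `[0, 1] f] `&`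
    (fun z : X => z.1.1) @^-1` [set f | forall x, x \in `]0, 1[ -> 0 < 1 * (x - f x)] `&`
    (fun z : X => z.1.2) @^-1` [set f | forall x, x \in `]0, 1[ -> 0 < -1 * (x - f x)] `&`
    [set z | 0 < z.2] `&` [set z | z.2 < 1] `&`
    [set z | 0 < Lambda0 z] `&` [set z | 0 < Lambda1 z].
  apply/seteqP; split=> [_ [[f0 f1 p fP] _ <-]|].
    have [h0 h1 lt0 lt1 p01 L0 L1] := fP; move: p01; rewrite in_itv/= => /andP[p0 p1].
    do !split => //=; [by move=> x /lt0; lra|].
    by move=> x /lt1; lra.
  move=> [[f0 f1] p] [[[[[[[h0 h1] lt0] lt1] p0] p1] L0] L1].
  have P : isRDS f0 f1 p.
    split => //; last by rewrite in_itv/= p0.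
      by move=> x /lt0; lra.
    by move=> x /lt1; lra.
  by exists (MkRDS P).
have cln0 := @continuous_ln_rderive0 R; have cln1 := @continuous_ln_lderive1 R.
do ?apply: GdeltaI.
- exact: Gdelta_preimage Gdelta_homeomorphism.
- exact: Gdelta_preimage Gdelta_homeomorphism.
- by apply: Gdelta_preimage (Gdelta_shift _); rewrite ?normr1.
- by apply: Gdelta_preimage (Gdelta_shift _); rewrite ?normrN1.
- by apply/open_Gdelta/open_lt_continuous; [exact: cc|exact: c2].
- by apply/open_Gdelta/open_lt_continuous; [exact: c2|exact: cc].
- by apply/open_Gdelta/open_lt_continuous; [exact: cc|exact: cL cln0].
- by apply/open_Gdelta/open_lt_continuous; [exact: cc|exact: cL cln1].
Qed.

End RDS_Gdelta.

Theorem theorem2p7 (R : realType) : baire_space (RDS R).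
Proof.
apply: (Gdelta_baire_space _ (@ball_RDS_triple R) Gdelta_range_RDS_triple).
apply: complete_space_prod; last by move=> F FF /cauchy_cvg/cvg_ex.
by apply: complete_space_prod; exact: CI_complete.
Qed.
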